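(* Each three-dimensional solvable subalgebra of $\mathfrak{sp}(4,\mathbb{C})$ containing a Cartan subalgebra is conjugate to exactly one of the following inequivalent subalgebras: $$\langle\mathfrak{t},X_{\alpha}\rangle,\qquad \langle\mathfrak{t},X_{\beta}\rangle .$$ Moreover, $\langle\mathfrak{t},X_{\alpha}\rangle\sim\langle\mathfrak{t},X_{\alpha+2\beta}\rangle$ and $\langle\mathfrak{t},X_{\beta}\rangle\sim\langle\mathfrak{t},X_{\alpha+\beta}\rangle$.
   Context: Let $J=\begin{pmatrix}0&0&1&0\\0&0&0&1\\-1&0&0&0\\0&-1&0&0\end{pmatrix}$. $\mathfrak{sp}(4,\mathbb{C})$ is the Lie algebra of $4\times4$ complex matrices $X$ with $JX^tJ=X$, and $Sp(4,\mathbb{C})=\{g\in GL(4,\mathbb{C}) : gJg^t=J\}$, acting on $\mathfrak{sp}(4,\mathbb{C})$ by conjugation $X\mapsto gXg^{-1}$. For $a,b\in\mathbb{C}$, $T_{a,b}=\mathrm{diag}(a,b,-a,-b)$, and $\mathfrak{t}=\{T_{a,b}: a,b\in\mathbb{C}\}$. A Cartan subalgebra of $\mathfrak{sp}(4,\mathbb{C})$ is a two-dimensional subalgebra of commuting semisimple (diagonalizable) elements. With $E_{ij}$ the matrix units, $X_\alpha=E_{24}$, $X_\beta=E_{12}-E_{43}$, $X_{\alpha+\beta}=E_{14}+E_{23}$, $X_{\alpha+2\beta}=E_{13}$. $\langle\,\cdot\,\rangle$ denotes the complex linear span of the listed elements and subspaces. Two subalgebras are equivalent (conjugate), written $\sim$,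 if some $g\in Sp(4,\mathbb{C})$ conjugates one onto the other. *)

(* Defs.v *)
From mathcomp Require Import all_boot all_order all_algebra.
From mathcomp Require Import reals complex.

Set Implicit Arguments.
Unset Strict Implicit.
Unset Printing Implicit Defensive.

Import GRing.Theory.
Local Open Scope ring_scope.

Section LieMatrices.
Variables (F : fieldType) (n : nat).
Implicit Types (X Y : 'M[F]_n) (U V W L : {vspace 'M[F]_n}).

Definition lie_bracket X Y : 'M[F]_n := X *m Y - Y *m X.

Lemma lie_bracketDl Y X1 X2 a :
  lie_bracket (a *: X1 + X2) Y = a *: lie_bracket X1 Y + lie_bracket X2 Y.
Proof.
rewrite /lie_bracket mulmxDl mulmxDr -scalemxAl -scalemxAr scalerBr opprD.
by rewrite addrACA.
Qed.

Lemma lie_bracketC X Y : lie_bracket X Y = - lie_bracket Y X.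
Proof. by rewrite /lie_bracket opprB. Qed.

(* By bilinearity this is the span of all [X, Y] with X in U and Y in V: see
   [lie_prodv_subP]. *)
Definition lie_prodv U V : {vspace 'M[F]_n} :=
  <<[seq lie_bracket X Y | X <- vbasis U, Y <- vbasis V]>>%VS.

Lemma mem_lie_prodv U V X Y :
  X \in U -> Y \in V -> lie_bracket X Y \in lie_prodv U V.
Proof.
have lin W Z Z' (e : seq 'M[F]_n) : Z \in <<e>>%VS ->
  {in e, forall A, lie_bracket A Z' \in W} -> lie_bracket Z Z' \in W.
  elim: e Z => [|A e IHe] Z.
    by rewrite span_nil memv0 => /eqP->; rewrite /lie_bracket mul0mx mulmx0 subrr mem0v.
  rewrite span_cons => /memv_addP[_ /vlineP[k ->] [B Be ->]] eW.
  rewrite lie_bracketDl; apply: memvD; first by rewrite memvZ ?eW ?mem_head.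
  apply: IHe Be _ => C Ce.
  by rewrite eW// inE Ce orbT.
rewrite -{1}(span_basis (vbasisP U)) -{1}(span_basis (vbasisP V)) => XU YV.
apply: (lin) XU _ => A AU; rewrite lie_bracketC memvN.
apply: lin YV _ => B BV; rewrite lie_bracketC memvN.
exact/memv_span/allpairs_f.
Qed.

Lemma lie_prodv_subP U V W :
  reflect {in U & V, forall X Y, lie_bracket X Y \in W} (lie_prodv U V <= W)%VS.
Proof.
apply: (iffP idP) => [/subvP sW X Y XU YV|UVW]; first exact/sW/mem_lie_prodv.
apply/span_subvP => _ /allpairsP[[A B] /= [AU BV ->]].
by apply: UVW; apply: vbasis_mem.
Qed.

Fixpoint lie_derived k L : {vspace 'M[F]_n} :=
  if k is k'.+1 then lie_prodv (lie_derived k' L) (lie_derived k' L) else L.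

Definition lie_solvable L : Prop := exists k, lie_derived k L = 0%VS.

Definition lie_subalgebra (g : {pred 'M[F]_n}) L : Prop :=
  {subset L <= g} /\ {in L &, forall X Y, lie_bracket X Y \in L}.

Definition conjv (g : 'M[F]_n) L : {vspace 'M[F]_n} :=
  (linfun (mulmxr (invmx g) \o mulmx g) @: L)%VS.

Lemma mem_conjv g L Y :
  reflect (exists2 X, X \in L & Y = g *m X *m invmx g) (Y \in conjv g L).
Proof.
by apply: (iffP memv_imgP) => -[X XL ->]; exists X => //; rewrite lfunE.
Qed.

End LieMatrices.

Section Sp4.
Variable F : fieldType.
Implicit Types (X g : 'M[F]_4) (H L : {vspace 'M[F]_4}).

Definition J4 : 'M[F]_4 :=
  \matrix_(i, j) (nth [::] [:: [:: 0; 0; 1; 0];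
                               [:: 0; 0; 0; 1];
                               [:: -1; 0; 0; 0];
                               [:: 0; -1; 0; 0]] i)`_j.

Definition sp4 : {pred 'M[F]_4} := [pred X | J4 *m X^T *m J4 == X].

Definition Sp4 : {pred 'M[F]_4} :=
  [pred g | (g \in unitmx) && (g *m J4 *m g^T == J4)].

(* The matrix unit E_ij, with 1-based indices. *)
Definition E4 (i j : nat) : 'M[F]_4 := delta_mx (inord i.-1) (inord j.-1).

Definition T4 (a b : F) : 'M[F]_4 := diag_mx (\row_j [:: a; b; - a; - b]`_j).

Definition t4 : {vspace 'M[F]_4} := <<[:: T4 1 0; T4 0 1]>>%VS.

Lemma mem_t4 X : reflect (exists a b, X = T4 a b) (X \in t4).
Proof.
have TE a b : T4 a b = a *: T4 1 0 + b *: T4 0 1.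
  apply/matrixP => i j; rewrite !mxE.
  rewrite !mulrnAr -mulrnDl; congr (_ *+ _).
  case: i => [[|[|[|[|i]]]] //= _];
    by rewrite ?oppr0 ?mulrN ?mulr0 ?mulr1 ?oppr0 ?addr0 ?add0r.
rewrite /t4 span_cons span_seq1; apply: (iffP memv_addP).
  by move=> [_ /vlineP[a ->] [_ /vlineP[b ->] ->]]; exists a, b; rewrite [RHS]TE.
move=> [a [b ->]]; exists (a *: T4 1 0); first by rewrite memvZ ?memv_line.
by exists (b *: T4 0 1); rewrite ?memvZ ?memv_line// [LHS]TE.
Qed.

Definition X_alpha : 'M[F]_4 := E4 2 4.
Definition X_beta : 'M[F]_4 := E4 1 2 - E4 4 3.
Definition X_alpha_beta : 'M[F]_4 := E4 1 4 + E4 2 3.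
Definition X_alpha_2beta : 'M[F]_4 := E4 1 3.

Definition sp4_cartan H : Prop :=
  [/\ lie_subalgebra sp4 H,
      \dim H = 2%N,
      {in H &, forall X Y, lie_bracket X Y = 0} &
      {in H, forall X, diagonalizable X}].

Definition sp4_equiv L L' : Prop := exists2 g, g \in Sp4 & conjv g L = L'.

Definition solvable3_with_cartan L : Prop :=
  [/\ lie_subalgebra sp4 L,
      \dim L = 3%N,
      lie_solvable L &
      exists2 H, sp4_cartan H & (H <= L)%VS].

End Sp4.

(* Main.v *)
(**
A Cartan subalgebra H is diagonal in some basis of row vectors.  The symplectic
form pairs only weight spaces of opposite weights, so, after a permutation, the
basis has weights a, b, -a, -b; as dim H = 2, some element of H has weights
1, 2, -1, -2, hence the Gram matrix vanishes outside the pairs (1,3) and (2,4),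
and rescaling two vectors makes the basis symplectic.  So H is conjugate to t.

A three-dimensional subalgebra containing t is t + <v> with v of zero diagonal,
and v is an eigenvector of ad T_{1,2}, whose eigenvalues on the eight root
spaces are distinct: v spans a root space.  Two Weyl group elements move every
root line to that of alpha or of beta.  The two classes differ because the
derived algebra is the root line, and X_alpha has rank 1 while X_beta has rank 2.
*)

Require Import Defs.
From mathcomp Require Import all_boot all_order all_algebra.
From mathcomp Require Import fingroup perm ring.
From mathcomp Require Import reals complex.

Set Implicit Arguments.
Unset Strict Implicit.
Unset Printing Implicit Defensive.

Import Order.TTheory GRing.Theory Num.Theory.
Local Open Scope ring_scope.

(** * Conjugation of matrix spaces *)

Section Conjugation.
Variables (F : fieldType) (n : nat).
Implicit Types (g h X Y : 'M[F]_n) (L : {vspace 'M[F]_n}).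

Lemma lie_bracket_conj g X Y : g \in unitmx ->
  lie_bracket (g *m X *m invmx g) (g *m Y *m invmx g) =
  g *m lie_bracket X Y *m invmx g.
Proof.
move=> gu; rewrite /lie_bracket mulmxBr mulmxBl !mulmxA.
by rewrite !(mulmxKV gu).
Qed.

Lemma conjv_comp g h L : g \in unitmx -> h \in unitmx ->
  conjv g (conjv h L) = conjv (g *m h) L.
Proof.
move=> gu hu; have ghV : invmx (g *m h) = invmx h *m invmx g.
  (* [invrM] needs the ring of square matrices, hence a nonzero size; in size 0 all matrices are
     equal. *)
  by case: n g h gu hu {L} => [|k] g h gu hu; [rewrite !flatmx0|apply: invrM].
apply/vspaceP => Y; apply/mem_conjv/mem_conjv.
  by move=> [_ /mem_conjv[X XL ->] ->]; exists X; rewrite // ghV !mulmxA.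
move=> [X XL ->]; exists (h *m X *m invmx h); first by apply/mem_conjv; exists X.
by rewrite ghV !mulmxA.
Qed.

Lemma conjv1 L : conjv 1%:M L = L.
Proof.
apply/vspaceP => Y; apply/mem_conjv/idP => [[X XL ->]|YL].
  by rewrite invmx1 mulmx1 mul1mx.
by exists Y; rewrite ?invmx1 ?mulmx1 ?mul1mx.
Qed.

Lemma conjvK g L : g \in unitmx -> conjv (invmx g) (conjv g L) = L.
Proof. by move=> gu; rewrite conjv_comp ?unitmx_inv// mulVmx// conjv1. Qed.

Lemma dim_conjv g L : g \in unitmx -> \dim (conjv g L) = \dim L.
Proof.
move=> gu; apply/limg_dim_eq/eqP; rewrite -subv0; apply/subvP => X.
rewrite memv_cap memv_ker lfunE /= memv0 => /andP[_ /eqP gX0]; apply/eqP.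
by rewrite -[X](mulKmx gu) -[g *m X](mulmxKV gu) gX0 mul0mx mulmx0.
Qed.

Lemma subv_conjv g L L' :
  {in L, forall X, g *m X *m invmx g \in L'} -> (conjv g L <= L')%VS.
Proof. by move=> gL; apply/subvP => _ /mem_conjv[X XL ->]; apply: gL. Qed.

Lemma mem_conjv_conj g L X : X \in L -> g *m X *m invmx g \in conjv g L.
Proof. by move=> XL; apply/mem_conjv; exists X. Qed.

End Conjugation.

(** * The symplectic form, its group and two Weyl group elements *)

Section SymplecticGroup.
Variable F : fieldType.
Implicit Types (A B X g : 'M[F]_4) (H L : {vspace 'M[F]_4}).

Definition M4 (s : seq (seq F)) : 'M[F]_4 := \matrix_(i, j) (nth [::] s i)`_j.

Ltac mx44 := apply/matrixP => - [[|[|[|[|i]]]]// hi] [[|[|[|[|j]]]]// hj];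
  rewrite !(mxE, big_ord_recl, big_ord0) /= ?eqE /= ?inordK//=; try ring.

Lemma J4J4 : J4 F *m J4 F = - 1%:M.
Proof. mx44. Qed.

Lemma J4_tr : (J4 F)^T = - J4 F.
Proof. mx44. Qed.

Lemma sum4E (f : 'I_4 -> F) :
  \sum_k f k = f (inord 0) + f (inord 1) + f (inord 2) + f (inord 3).
Proof.
rewrite !big_ord_recl big_ord0 addr0 !addrA.
by congr (f _ + f _ + f _ + f _); apply: val_inj; rewrite /= inordK.
Qed.

Lemma mul_J4 A : A *m J4 F = \matrix_(i, j)
  [:: - A i (inord 2); - A i (inord 3); A i (inord 0); A i (inord 1)]`_j.
Proof.
apply/matrixP => i j; rewrite !mxE sum4E !mxE !inordK//.
by case: j => [[|[|[|[|j]]]]// _] /=; ring.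
Qed.

(** This is the symplectic form on row [i] of [A] and row [j] of [B]. *)
Lemma mul_J4_tr A B i j : (A *m J4 F *m B^T) i j =
  A i (inord 0) * B j (inord 2) + A i (inord 1) * B j (inord 3)
  - A i (inord 2) * B j (inord 0) - A i (inord 3) * B j (inord 1).
Proof. by rewrite mul_J4 mxE sum4E !mxE !inordK//=; ring. Qed.

Lemma J4_unit : J4 F \in unitmx.
Proof.
have : J4 F *m - J4 F = 1%:M by rewrite mulmxN J4J4 opprK.
by case/mulmx1_unit.
Qed.

Lemma Sp4_unit g : g \in @Sp4 F -> g \in unitmx.
Proof. by case/andP. Qed.

Lemma Sp4_mul g h : g \in @Sp4 F -> h \in @Sp4 F -> g *m h \in @Sp4 F.
Proof.
case/andP=> gu /eqP gJ /andP[hu /eqP hJ]; rewrite inE unitmx_mul gu hu /=.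
by rewrite trmx_mul !mulmxA -(mulmxA g h) -(mulmxA g) hJ gJ.
Qed.

Lemma Sp4_inv g : g \in @Sp4 F -> invmx g \in @Sp4 F.
Proof.
case/andP=> gu /eqP gJ; rewrite inE unitmx_inv gu /= -{1}gJ.
by rewrite !mulmxA mulVmx// mul1mx trmx_inv mulmxK ?unitmx_tr.
Qed.

(** Multiply by [J4 F], whose square is -1. As [J4 F] is skew, the condition says that [X *m J4 F]
    is symmetric. *)
Lemma sp4E X : (X \in @sp4 F) = (X *m J4 F == - (J4 F *m X^T)).
Proof.
rewrite inE; apply/eqP/eqP => [{1}<-|XJ].
  by rewrite -!mulmxA J4J4 !mulmxN mulmx1.
by rewrite -[J4 F *m _]opprK -XJ mulNmx -mulmxA J4J4 mulmxN opprK mulmx1.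
Qed.

Lemma sp4_conj g X : g \in @Sp4 F -> X \in @sp4 F ->
  g *m X *m invmx g \in @sp4 F.
Proof.
case/andP=> gu /eqP gJ; rewrite !sp4E => /eqP XJ; apply/eqP.
have gVJ : invmx g *m J4 F = J4 F *m g^T.
  by rewrite -{1}gJ !mulmxA mulVmx// mul1mx.
have gJV : g *m J4 F = J4 F *m invmx g^T.
  by rewrite -{2}gJ mulmxK ?unitmx_tr.
rewrite -mulmxA gVJ -!mulmxA (mulmxA X) XJ mulNmx mulmxN; congr (- _).
by rewrite !trmx_mul trmx_inv !mulmxA gJV.
Qed.

Lemma sp4_equiv_sym L L' : sp4_equiv L L' -> sp4_equiv L' L.
Proof.
case=> g gS <-; exists (invmx g); first exact: Sp4_inv.
by rewrite conjvK// Sp4_unit.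
Qed.

Lemma sp4_equiv_trans L L' L'' :
  sp4_equiv L L' -> sp4_equiv L' L'' -> sp4_equiv L L''.
Proof.
case=> g gS <- [h hS <-]; exists (h *m g); first exact: Sp4_mul.
by rewrite conjv_comp// Sp4_unit.
Qed.

Lemma lie_subalgebra_conj g L : g \in @Sp4 F ->
  lie_subalgebra (@sp4 F) L -> lie_subalgebra (@sp4 F) (conjv g L).
Proof.
move=> gS [Lsp Lbr]; split.
  by move=> _ /mem_conjv[X XL ->]; rewrite sp4_conj ?Lsp.
move=> _ _ /mem_conjv[X XL ->] /mem_conjv[Y YL ->].
by rewrite lie_bracket_conj ?Sp4_unit// mem_conjv_conj// Lbr.
Qed.

Lemma root_vectors_M4 : [/\
  X_alpha F = M4 [:: [:: 0;0;0;0]; [:: 0;0;0;1]; [:: 0;0;0;0]; [:: 0;0;0;0]],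
  X_alpha_2beta F = M4 [:: [:: 0;0;1;0]; [:: 0;0;0;0]; [:: 0;0;0;0]; [:: 0;0;0;0]],
  X_beta F = M4 [:: [:: 0;1;0;0]; [:: 0;0;0;0]; [:: 0;0;0;0]; [:: 0;0;-1;0]] &
  X_alpha_beta F = M4 [:: [:: 0;0;0;1]; [:: 0;0;1;0]; [:: 0;0;0;0]; [:: 0;0;0;0]]].
Proof. by split; mx44. Qed.

(** Represents the reflection in the short root beta, of weight a - b. *)
Definition weyl_swap : 'M[F]_4 :=
  M4 [:: [:: 0; 1; 0; 0]; [:: 1; 0; 0; 0]; [:: 0; 0; 0; 1]; [:: 0; 0; 1; 0]].

(** Represents the reflection in the long root alpha, of weight 2b; the entry -1 makes it
    symplectic. *)
Definition weyl_flip : 'M[F]_4 :=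
  M4 [:: [:: 1; 0; 0; 0]; [:: 0; 0; 0; 1]; [:: 0; 0; 1; 0]; [:: 0; -1; 0; 0]].

Lemma Sp4I g : g *m J4 F *m g^T = J4 F -> g \in @Sp4 F.
Proof.
move=> gJ; rewrite inE gJ eqxx andbT.
have := J4_unit; rewrite -gJ unitmx_mul => /andP[].
by rewrite unitmx_mul => /andP[].
Qed.

Lemma weyl_swap_Sp4 : weyl_swap \in @Sp4 F.
Proof.
apply/Sp4I/matrixP => i j; rewrite mul_J4_tr !mxE !inordK//.
by case: i j => [[|[|[|[|i]]]]// hi] [[|[|[|[|j]]]]// hj] /=; ring.
Qed.

Lemma weyl_flip_Sp4 : weyl_flip \in @Sp4 F.
Proof.
apply/Sp4I/matrixP => i j; rewrite mul_J4_tr !mxE !inordK//.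
by case: i j => [[|[|[|[|i]]]]// hi] [[|[|[|[|j]]]]// hj] /=; ring.
Qed.

Lemma weyl_swap_T4 a b : weyl_swap *m T4 a b = T4 b a *m weyl_swap.
Proof.
rewrite mul_mx_diag mul_diag_mx; apply/matrixP => i j; rewrite !mxE.
by case: i j => [[|[|[|[|i]]]]// hi] [[|[|[|[|j]]]]// hj] /=; ring.
Qed.

Lemma weyl_flip_T4 a b : weyl_flip *m T4 a b = T4 a (- b) *m weyl_flip.
Proof.
rewrite mul_mx_diag mul_diag_mx; apply/matrixP => i j; rewrite !mxE.
by case: i j => [[|[|[|[|i]]]]// hi] [[|[|[|[|j]]]]// hj] /=; ring.
Qed.

End SymplecticGroup.

(** * Common eigenbases and their Gram matrices *)

Section Torus.
Variable F : fieldType.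
Implicit Types (A B P X g : 'M[F]_4) (H L : {vspace 'M[F]_4}).

Lemma dim_t4 : \dim (t4 F) = 2%N.
Proof.
apply/eqP; change (\dim (t4 F) == size [:: T4 (1 : F) 0; T4 (0 : F) 1]).
rewrite [_ == _](_ : _ = free [:: T4 (1 : F) 0; T4 (0 : F) 1])//.
rewrite free_cons seq1_free span_seq1; apply/andP; split.
  apply/negP => /vlineP[k /matrixP/(_ ord0 ord0)/eqP].
  by rewrite !mxE /= mulr0 oner_eq0.
apply/eqP => /matrixP/(_ (inord 1) (inord 1))/eqP.
by rewrite !mxE !inordK// eqxx /= oner_eq0.
Qed.

Lemma T4_t4 a b : T4 a b \in t4 F.
Proof. by apply/mem_t4; exists a, b. Qed.

(** Equal dimensions turn the inclusion in [t4 F] into an equality. *)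
Lemma conjv_t4 g H : g \in unitmx -> \dim H = 2%N ->
  {in H, forall X, exists a b, g *m X = T4 a b *m g} -> conjv g H = t4 F.
Proof.
move=> gu H2 gH; apply/eqP; rewrite eqEdim dim_conjv// H2 dim_t4 leqnn andbT.
apply/subv_conjv => X /gH[a [b ->]]; rewrite mulmxK//; exact: T4_t4.
Qed.

(** A basis of [H] is codiagonalizable, and the vanishing of off-diagonal entries extends to [H] by
    linearity. *)
Lemma simult_diag H : {in H &, forall X Y, lie_bracket X Y = 0} ->
  {in H, forall X, diagonalizable X} ->
  exists2 P, P \in unitmx & {in H, forall X, exists d, P *m X = diag_mx d *m P}.
Proof.
move=> Hc Hd; have [|P Pu /allP PH] := (codiagonalizableP (vbasis H)).1.
  split=> [A B AH BH|A AH]; last exact/Hd/vbasis_mem.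
  by apply/eqP; rewrite -subr_eq0; apply/eqP/Hc; apply: vbasis_mem.
exists P => // X XH; suff /is_diag_mxP/diag_mxP[d Dd] :
    forall i j : 'I_4, i != j :> nat -> (P *m X *m invmx P) i j = 0.
  by exists d; rewrite -Dd mulmxKV.
move=> i j ij; rewrite (coord_vbasis XH) mulmx_sumr mulmx_suml summxE big1// => k _.
rewrite -scalemxAr -scalemxAl mxE.
have /PH/(diagonalizable_forP _ Pu)-> : (vbasis H)`_k \in vbasis H.
- by rewrite mem_nth ?size_tuple.
- by rewrite mulr0.
- exact: ij.
Qed.

(** The basis vectors are the rows of [P]. *)
Definition gram P := P *m J4 F *m P^T.

Lemma gram_skew P i j : gram P i j = - gram P j i.
Proof. by rewrite /gram !mul_J4_tr; ring. Qed.

(** In characteristic 2 this does not follow from [gram_skew]. *)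
Lemma gram_alt P i : gram P i i = 0.
Proof. by rewrite /gram !mul_J4_tr; ring. Qed.

(** The expression is the Pfaffian of the Gram matrix [G], and [G *m K] is that scalar. If it is 0,
    then [K] is 0 because [G] is invertible; but [K] has the entries of [G] up to place and sign, so
    [G] is 0 too. *)
Lemma gram_pfaffian P (q := fun i j : nat => gram P (inord i) (inord j)) :
  P \in unitmx ->
  q 0%N 1%N * q 2%N 3%N - q 0%N 2%N * q 1%N 3%N + q 0%N 3%N * q 1%N 2%N != 0.
Proof.
move=> Pu; apply/eqP => pf0; set G := gram P in q pf0.
have Gu : G \in unitmx by rewrite !unitmx_mul unitmx_tr Pu J4_unit.
(* K is the Pfaffian adjugate of G. *)
pose K : 'M[F]_4 := M4 [:: [:: 0; - q 2%N 3%N; q 1%N 3%N; - q 1%N 2%N];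
  [:: q 2%N 3%N; 0; - q 0%N 3%N; q 0%N 2%N]; [:: - q 1%N 3%N; q 0%N 3%N; 0; - q 0%N 1%N];
  [:: q 1%N 2%N; - q 0%N 2%N; q 0%N 1%N; 0]].
have G4 : G = M4 [:: [:: 0; q 0%N 1%N; q 0%N 2%N; q 0%N 3%N];
    [:: - q 0%N 1%N; 0; q 1%N 2%N; q 1%N 3%N];
    [:: - q 0%N 2%N; - q 1%N 2%N; 0; q 2%N 3%N];
    [:: - q 0%N 3%N; - q 1%N 3%N; - q 2%N 3%N; 0]].
  apply/matrixP => i j; have -> : G i j = q i j by rewrite /q !inord_val.
  rewrite mxE; case: i j => [[|[|[|[|i]]]]// hi] [[|[|[|[|j]]]]// hj] /=;
    by rewrite /q ?gram_alt// -gram_skew.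
have GK : G *m K =
    (q 0%N 1%N * q 2%N 3%N - q 0%N 2%N * q 1%N 3%N + q 0%N 3%N * q 1%N 2%N)%:M.
  apply/matrixP => i j; rewrite G4 !mxE sum4E !mxE !inordK//.
  by case: i j => [[|[|[|[|i]]]]// hi] [[|[|[|[|j]]]]// hj] /=; ring.
have K0 : K = 0 by rewrite -[K](mulKmx Gu) GK pf0 raddf0 mulmx0.
have q0 i j : (i < 4)%N -> (j < 4)%N -> K (inord i) (inord j) = 0.
  by rewrite K0 mxE.
have G0 : G = 0.
  (* At these six places of [K] the entries of [G] above the diagonal stand without a sign. *)
  move: (q0 1 0 isT isT) (q0 0 2 isT isT) (q0 3 0 isT isT).
  move: (q0 2 1 isT isT) (q0 1 3 isT isT) (q0 3 2 isT isT).
  rewrite !mxE !inordK// /= G4 => -> -> -> -> -> ->; apply/matrixP => i j; rewrite !mxE.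
  by case: i j => [[|[|[|[|i]]]]// hi] [[|[|[|[|j]]]]// hj] /=; rewrite ?oppr0.
by move: Gu; rewrite G0 unitmxE det0 unitr0.
Qed.

(** The rows of [P] are a basis of common eigenvectors for the action on row vectors from the
    right. *)
Definition eigenframe H P :=
  P \in unitmx /\ {in H, forall X, exists d, P *m X = diag_mx d *m P}.

Lemma eigenframe_perm H P s : eigenframe H P -> eigenframe H (row_perm s P).
Proof.
move=> [Pu PH]; split; first by rewrite row_permE unitmx_mul unitmx_perm.
move=> X /PH[d PX]; exists (col_perm s d).
rewrite {1}row_permE -mulmxA PX -row_permE !mul_diag_mx.
by apply/matrixP => i j; rewrite !mxE.
Qed.

Lemma gram_row_perm P s i j :
  gram (row_perm s P) i j = gram P (s i) (s j).
Proof. by rewrite /gram !mul_J4_tr !mxE. Qed.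

(** The three terms of the Pfaffian are the three perfect matchings of four indices. One term is
    nonzero, and a transposition moves its matching to {0,2}, {1,3}. *)
Lemma eigenframe_paired H P : eigenframe H P ->
  exists2 P', eigenframe H P' &
    gram P' (inord 0) (inord 2) != 0 /\
    gram P' (inord 1) (inord 3) != 0.
Proof.
move=> PH; have /= pf := gram_pfaffian PH.1.
pose paired i j k l := gram P i j != 0 /\ gram P k l != 0.
have [q02|] : paired (inord 0) (inord 2) (inord 1) (inord 3) \/
    (paired (inord 0) (inord 1) (inord 2) (inord 3) \/
     paired (inord 0) (inord 3) (inord 1) (inord 2)).
- have nz i j k l : gram P i j * gram P k l != 0 -> paired i j k l.
    by rewrite mulf_eq0 negb_or => /andP.
  have [/eqP q02|/nz] :=
    boolP (gram P (inord 0) (inord 2) * gram P (inord 1) (inord 3) == 0); last by left.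
  right; have [/eqP q01|/nz] :=
    boolP (gram P (inord 0) (inord 1) * gram P (inord 2) (inord 3) == 0); last by left.
  by right; apply: nz; move: pf; rewrite q01 q02 subrr add0r.
- by exists P.
have ne a b : (a < 4)%N -> (b < 4)%N -> a != b -> (inord a : 'I_4) != inord b.
  by move=> a4 b4; rewrite -val_eqE /= !inordK.
case=> [[q01 q23]|[q03 q12]].
  exists (row_perm (tperm (inord 1) (inord 2)) P); first exact: eigenframe_perm.
  by rewrite !gram_row_perm tpermL tpermR !tpermD ?ne.
exists (row_perm (tperm (inord 2) (inord 3)) P); first exact: eigenframe_perm.
by rewrite !gram_row_perm tpermL tpermR !tpermD ?ne.
Qed.

(** [X] is skew for the symplectic form, so eigenvectors whose weights are not opposite are
    orthogonal. *)
Lemma gram_weight P X d i j : X \in @sp4 F -> P *m X = diag_mx d *m P ->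
  (d 0 i + d 0 j) * gram P i j = 0.
Proof.
rewrite sp4E => /eqP XJ PX; set G := gram P.
have : diag_mx d *m G = - (G *m diag_mx d).
  rewrite /G /gram !mulmxA -PX -(mulmxA P) XJ mulmxN mulNmx; congr (- _).
  by rewrite -!mulmxA -trmx_mul PX trmx_mul tr_diag_mx.
rewrite mul_diag_mx mul_mx_diag => /matrixP/(_ i j); rewrite !mxE => GE.
by rewrite mulrDl GE mulrC addNr.
Qed.
End Torus.

(** * Conjugacy of Cartan subalgebras, in characteristic 0 *)

Section CartanConjugacy.
Variable F : numFieldType.
Implicit Types (A B P X g : 'M[F]_4) (H L : {vspace 'M[F]_4}).

Lemma cartan_conj_t4 H : sp4_cartan H -> sp4_equiv H (t4 F).
Proof.
move=> [[Hsp _] H2 Hc Hd].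
have [P0 P0u P0H] := simult_diag Hc Hd.
have [P [Pu PH] [q02 q13]] := eigenframe_paired (conj P0u P0H).
set G := gram P in q02 q13.
(* The nonzero Gram entries at (0,2) and (1,3) force the weights there to be opposite. *)
have PT : {in H, forall X, exists a b, P *m X = T4 a b *m P}.
  move=> X XH; have [d PX] := PH X XH; exists (d 0 (inord 0)), (d 0 (inord 1)).
  have GW := fun i j => gram_weight i j (Hsp _ XH) PX.
  rewrite PX; congr (diag_mx _ *m _); apply/rowP => j; rewrite mxE.
  have opp i k : G i k != 0 -> d 0 k = - d 0 i.
    move=> Gik; move/eqP: (GW i k).
    by rewrite mulf_eq0 (negPf Gik) orbF addrC addr_eq0 => /eqP.
  rewrite -(opp _ _ q02) -(opp _ _ q13) -{1}(inord_val j).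
  by case: j => [[|[|[|[|j]]]]// hj].
have cPt := conjv_t4 Pu H2 PT.
(* Among the weights 1, 2, -1, -2 only the pairs (0,2) and (1,3) have sum 0, so one element of [H]
   kills the other Gram entries above the diagonal. *)
have /mem_conjv[X XH TX] : T4 1 2%:R \in conjv P H by rewrite cPt T4_t4.
have {TX} PX : P *m X = T4 1 2%:R *m P by rewrite TX mulmxKV.
have G0 i j : (i < 4)%N -> (j < 4)%N ->
    [:: 1; 2%:R; - 1; - 2%:R]`_i + [:: 1; 2%:R; - 1; - 2%:R]`_j != 0 :> F ->
    G (inord i) (inord j) = 0.
  move=> i4 j4 ij0; have /eqP := gram_weight (inord i) (inord j) (Hsp _ XH) PX.
  by rewrite !mxE !inordK// mulf_eq0 (negPf ij0) => /eqP.
have tau0 (m : int) : m != 0 -> m%:~R != 0 :> F by rewrite intr_eq0.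
have G01 : G (inord 0) (inord 1) = 0.
  by apply: G0 => //=; rewrite (_ : _ + _ = 3%:Z%:~R) ?tau0//; ring.
have G03 : G (inord 0) (inord 3) = 0.
  by apply: G0 => //=; rewrite (_ : _ + _ = (-1)%:~R) ?tau0//; ring.
have G12 : G (inord 1) (inord 2) = 0.
  by apply: G0 => //=; rewrite (_ : _ + _ = 1%:~R) ?tau0//; ring.
have G23 : G (inord 2) (inord 3) = 0.
  by apply: G0 => //=; rewrite (_ : _ + _ = (-3)%:~R) ?tau0//; ring.
(* Scaling rows 0 and 1 makes the entries at (0,2) and (1,3) equal to 1, as in [J4 F]. *)
pose e : 'rV[F]_4 :=
  \row_j [:: (G (inord 0) (inord 2))^-1; (G (inord 1) (inord 3))^-1; 1; 1]`_j.
have gS : diag_mx e *m P \in @Sp4 F.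
  apply: Sp4I; apply/matrixP => i j.
  have -> : (diag_mx e *m P *m J4 F *m (diag_mx e *m P)^T) i j =
      e 0 i * G (inord i) (inord j) * e 0 j.
    rewrite trmx_mul tr_diag_mx !mulmxA mul_mx_diag mxE; congr (_ * _).
    by rewrite -!mulmxA (mulmxA P) mul_diag_mx mxE !inord_val.
  have sk := gram_skew P; rewrite -/G in sk.
  have alt a : G a a = 0 by apply: gram_alt.
  rewrite [e 0 i]mxE [e 0 j]mxE [RHS]mxE.
  case: i j => [[|[|[|[|i]]]]// hi] [[|[|[|[|j]]]]// hj] /=;
    rewrite ?alt ?(sk (inord 1) (inord 0)) ?(sk (inord 2) (inord 1))
      ?(sk (inord 3) (inord 0)) ?(sk (inord 3) (inord 2)) ?(sk (inord 2) (inord 0))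
      ?(sk (inord 3) (inord 1)) ?G01 ?G03 ?G12 ?G23;
    by rewrite ?oppr0 ?mulr0 ?mul0r ?mul1r ?mulr1 ?mulNr ?mulVf ?mulfV.
exists (diag_mx e *m P) => //; apply: conjv_t4 => //; first exact: Sp4_unit.
(* The scaling is diagonal, so it commutes with [T4 a b]. *)
move=> X' /PT[a [b PX']]; exists a, b.
by rewrite -!mulmxA PX' !mulmxA diag_mxC.
Qed.
End CartanConjugacy.

(** * Root spaces, the action of the Weyl group, and inequivalence *)

Section RootLines.
Variable F : numFieldType.
Implicit Types (A B X Y v g : 'M[F]_4) (H L : {vspace 'M[F]_4}).

Lemma lie_bracket_T4 a b X i j :
  lie_bracket (T4 a b) X i j =
  ([:: a; b; - a; - b]`_i - [:: a; b; - a; - b]`_j) * X i j.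
Proof.
by rewrite /lie_bracket mul_diag_mx mul_mx_diag !mxE mulrBl; congr (_ - _); rewrite mulrC.
Qed.

Definition root_vector X :=
  [/\ X \in @sp4 F, X \notin t4 F &
      forall a b, exists c, lie_bracket (T4 a b) X = c *: X].

(** The torus is abelian and [X] commutes with itself; only the cross terms remain, and these are
    multiples of [X]. *)
Lemma root_bracket X : root_vector X ->
  {in (t4 F + <[X]>)%VS &, forall A B, lie_bracket A B \in <[X]>%VS}.
Proof.
move=> [_ _ Xw] A B /memv_addP[_ /mem_t4[a [b ->]] [_ /vlineP[k ->] ->]].
move=> /memv_addP[_ /mem_t4[c [d ->]] [_ /vlineP[l ->] ->]].
have [p pE] := Xw a b; have [q qE] := Xw c d.
suff -> : lie_bracket (T4 a b + k *: X) (T4 c d + l *: X) =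
    l *: lie_bracket (T4 a b) X - k *: lie_bracket (T4 c d) X.
  by rewrite pE qE !scalerA -scalerBl memvZ ?memv_line.
rewrite /lie_bracket !(mulmxDl, mulmxDr) -!(scalemxAl, scalemxAr).
have -> : T4 a b *m T4 c d = T4 c d *m T4 a b by rewrite diag_mxC.
rewrite !scalerA (mulrC k) !scalerBr !opprD.
by apply/matrixP => i j; rewrite !mxE; ring.
Qed.

Lemma dim_t4_line X : X \notin t4 F -> \dim (t4 F + <[X]>) = 3%N.
Proof.
move=> Xt; have X0 : X != 0 by apply: contraNneq Xt => ->; rewrite mem0v.
rewrite dimv_disjoint_sum ?dim_t4 ?dim_vline ?X0//.
apply/eqP; rewrite -subv0; apply/subvP => Y; rewrite memv_cap memv0 => /andP[Yt].
move=> /vlineP[k YE]; move: Yt; rewrite YE scaler_eq0; case: eqVneq => //= k0.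
by move=> kX; rewrite -(scalerK k0 X) memvZ in Xt.
Qed.

Lemma t4_cartan : sp4_cartan (t4 F).
Proof.
have t4C : {in t4 F &, forall X Y, lie_bracket X Y = 0}.
  by move=> _ _ /mem_t4[a [b ->]] /mem_t4[c [d ->]]; rewrite /lie_bracket diag_mxC subrr.
split=> //; last 2 first.
- exact: dim_t4.
- by move=> _ /mem_t4[a [b ->]]; apply: diagonalizable_diag.
split; last by move=> X Y Xt Yt; rewrite t4C ?mem0v.
move=> _ /mem_t4[a [b ->]]; rewrite sp4E mul_J4; apply/eqP/matrixP => i j.
rewrite tr_diag_mx mul_mx_diag !mxE -!val_eqE /= !inordK//.
by case: i j => [[|[|[|[|i]]]]// hi] [[|[|[|[|j]]]]// hj] /=; ring.
Qed.

Lemma root_solvable3 X : root_vector X -> solvable3_with_cartan (t4 F + <[X]>)%VS.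
Proof.
move=> Xr; have [Xsp Xt _] := Xr; have [[tsp _] _ _ _] := t4_cartan.
have XL : (<[X]> <= t4 F + <[X]>)%VS by apply: addvSr.
split.
- split=> [_ /memv_addP[T /tsp Tsp [_ /vlineP[k ->] ->]]|A B AL BL].
    move: Tsp Xsp; rewrite !sp4E => /eqP TE /eqP XE.
    rewrite linearD linearZ /= mulmxDl mulmxDr opprD -scalemxAl -scalemxAr.
    by rewrite TE XE scalerN.
  exact/(subvP XL)/root_bracket.
- exact: dim_t4_line.
(* The derived algebra lies in the line of [X], so the second one vanishes. *)
- exists 2%N; apply/eqP; rewrite -subv0 /=; apply/lie_prodv_subP => A B.
  have sub : (lie_prodv (t4 F + <[X]>) (t4 F + <[X]>) <= <[X]>)%VS.
    exact/lie_prodv_subP/root_bracket.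
  move=> /(subvP sub)/vlineP[k ->] /(subvP sub)/vlineP[l ->].
  by rewrite /lie_bracket -!scalemxAl -!scalemxAr !scalerA mulrC subrr mem0v.
- by exists (t4 F); [exact: t4_cartan|exact: addvSl].
Qed.

Lemma t4_diag0 X : X \in t4 F -> (forall i, X i i = 0) -> X = 0.
Proof.
move=> /mem_t4[a [b ->]] X0; apply/matrixP => i j; rewrite !mxE.
by case: eqVneq => //= _; have := X0 i; rewrite !mxE eqxx.
Qed.

(** Intertwining relations replace conjugations, so that no inverse of [g] has to be computed. *)
Lemma t4_line_conj g X Y k : g \in @Sp4 F -> k != 0 ->
  (forall a b, exists c d, g *m T4 a b = T4 c d *m g) ->
  g *m X = k *: (Y *m g) ->
  sp4_equiv (t4 F + <[X]>)%VS (t4 F + <[Y]>)%VS.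
Proof.
move=> gS k0 gT gX; exists g => //; have gu := Sp4_unit gS.
rewrite /conjv limgD -/(conjv g _) limg_line lfunE /= gX -scalemxAl mulmxK//.
rewrite (conjv_t4 gu (dim_t4 F)); last by move=> _ /mem_t4[a [b ->]].
congr (_ + _)%VS; apply/vspaceP => Z; apply/vlineP/vlineP => -[c ->].
  by exists (c * k); rewrite scalerA.
by exists (c / k); rewrite scalerA divfK.
Qed.

Lemma weyl_swap_equiv X Y k : k != 0 ->
  weyl_swap F *m X = k *: (Y *m weyl_swap F) ->
  sp4_equiv (t4 F + <[X]>)%VS (t4 F + <[Y]>)%VS.
Proof.
by move=> k0; apply: t4_line_conj (weyl_swap_Sp4 F) k0 _ => a b;
   exists b, a; apply: weyl_swap_T4.
Qed.

Lemma weyl_flip_equiv X Y k : k != 0 ->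
  weyl_flip F *m X = k *: (Y *m weyl_flip F) ->
  sp4_equiv (t4 F + <[X]>)%VS (t4 F + <[Y]>)%VS.
Proof.
by move=> k0; apply: t4_line_conj (weyl_flip_Sp4 F) k0 _ => a b;
   exists a, (- b); apply: weyl_flip_T4.
Qed.

(* Coordinates are along the root spaces of
   beta, -beta, alpha+beta, -alpha-beta, alpha+2beta, -alpha-2beta, alpha, -alpha. *)
Definition root_part (x : 'rV[F]_8) : 'M[F]_4 :=
  let r k := x 0 (inord k) in
  M4 [:: [:: 0; r 0%N; r 4%N; r 2%N]; [:: r 1%N; 0; r 2%N; r 6%N];
         [:: r 5%N; r 3%N; 0; - r 1%N]; [:: r 3%N; r 7%N; - r 0%N; 0]].

Definition root (i : 'I_8) : 'M[F]_4 := root_part (delta_mx 0 i).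

(** The roots at [T4 a b], in the coordinate order of [root_part]. *)
Definition root_weight (a b : F) : seq F :=
  [:: a - b; b - a; a + b; - a - b; a + a; - a - a; b + b; - b - b].

(** Shows that [T4 1 2%:R] is regular: eight distinct integers stay distinct in characteristic 0. *)
Lemma root_weight12 : root_weight 1 2%:R =
  [seq m%:~R | m : int <- [:: -1; 1; 3; -3; 2; -2; 4; -4]].
Proof. by rewrite /root_weight /=; congr [:: _; _; _; _; _; _; _; _]; ring. Qed.

Lemma root_partZ k x : root_part (k *: x) = k *: root_part x.
Proof.
apply/matrixP => i j; rewrite !mxE.
by case: i j => [[|[|[|[|i]]]]// hi] [[|[|[|[|j]]]]// hj] /=; rewrite ?mulr0 ?mulrN.
Qed.

Lemma root_part_inj : injective root_part.
Proof.
move=> x y xy; have E i j := congr1 (fun A : 'M[F]_4 => A (inord i) (inord j)) xy.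
apply/rowP => k; rewrite -(inord_val k).
move: (E 0 1) (E 0 2) (E 0 3) (E 1 0) (E 1 3) (E 2 0) (E 2 1) (E 3 1).
rewrite !mxE !inordK//=.
by case: k => [[|[|[|[|[|[|[|[|k]]]]]]]]// hk].
Qed.

Lemma root_part_weight a b x :
  lie_bracket (T4 a b) (root_part x) =
  root_part (\row_j ((root_weight a b)`_j * x 0 j)).
Proof.
apply/matrixP => i j; rewrite lie_bracket_T4 !mxE !inordK//.
by case: i j => [[|[|[|[|i]]]]// hi] [[|[|[|[|j]]]]// hj] /=; ring.
Qed.

Lemma sp4_sym X i j : X \in @sp4 F -> (X *m J4 F) i j = (X *m J4 F) j i.
Proof.
rewrite sp4E => /eqP XJ; have {1}-> : X *m J4 F = (X *m J4 F)^T; last by rewrite mxE.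
by rewrite {1}XJ trmx_mul J4_tr mulNmx.
Qed.

Lemma root_partE v : v \in @sp4 F -> (forall i, v i i = 0) ->
  exists x, v = root_part x.
Proof.
move=> vsp vd.
have sym i j := sp4_sym i j vsp.
(* These four symmetries give the repeated entries of [root_part]; those at (0,2) and (1,3) concern
   only the diagonal. *)
move: (sym (inord 0) (inord 1)) (sym (inord 2) (inord 3)).
move: (sym (inord 0) (inord 3)) (sym (inord 1) (inord 2)).
rewrite mul_J4 !mxE !inordK//= => s03 s12 /oppr_inj s01 s23.
pose u i j := v (inord i) (inord j).
exists (\row_k [:: u 0 1; u 1 0; u 0 3; u 2 1; u 0 2; u 2 0; u 1 3; u 3 1]%N`_k).
apply/matrixP => i j; rewrite !mxE !inordK// /u /=.
rewrite -{1}(inord_val i) -{1}(inord_val j).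
case: i j => [[|[|[|[|i]]]]// hi] [[|[|[|[|j]]]]// hj] /=; 
  by rewrite ?vd ?s01 ?s23 ?s03 ?s12 ?opprK.
Qed.

(** Each nonzero coordinate of [v] forces [c] to be its weight; the weights are distinct, so only
    one coordinate is nonzero. *)
Lemma weight_vector_root v c : v \in @sp4 F -> v != 0 -> (forall i, v i i = 0) ->
  lie_bracket (T4 1 2%:R) v = c *: v ->
  exists2 k, k != 0 & exists i, v = k *: root i.
Proof.
move=> vsp v0 vd; have [x vx] := root_partE vsp vd; rewrite vx in v0 *.
rewrite root_part_weight -root_partZ => /root_part_inj/rowP xc.
have [i xi] : exists i, x 0 i != 0.
  apply/existsP; apply: contraNT v0; rewrite negb_exists => /forallP x0.
  apply/eqP; rewrite -[RHS](scale0r (root_part x)) -root_partZ; congr root_part.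
  by apply/rowP => i; rewrite !mxE mul0r; apply/eqP; rewrite -[_ == _]negbK.
exists (x 0 i) => //; exists i; rewrite /root -root_partZ; congr root_part.
have cE j : x 0 j != 0 -> c = (root_weight 1 2%:R)`_j.
  by move=> xj; have := xc j; rewrite !mxE => /(mulIf xj).
apply/rowP => j; rewrite !mxE eqxx /=; case: eqVneq => [->|ji]; first by rewrite mulr1.
rewrite mulr0; apply: contraNeq ji => /cE; rewrite (cE i)// => /eqP.
rewrite eq_sym nth_uniq ?size_tuple ?ltn_ord// root_weight12.
by rewrite (map_inj_uniq (@intr_inj F)).
Qed.

Lemma solvable3_t4_root L : lie_subalgebra (@sp4 F) L -> \dim L = 3%N ->
  (t4 F <= L)%VS -> exists i, L = (t4 F + <[root i]>)%VS.
Proof.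
move=> [Lsp Lbr] L3 tL.
have [v vL vt] : exists2 v, v \in L & v \notin t4 F.
  apply/subvPn; apply/negP => /dimvS; by rewrite L3 dim_t4.
(* The last two diagonal entries of [v] are minus the first two, so this removes the whole
   diagonal. *)
pose w := v - T4 (v (inord 0) (inord 0)) (v (inord 1) (inord 1)).
have wL : w \in L by rewrite memvB// (subvP tL)// T4_t4.
have wt : w \notin t4 F by rewrite rpredBr// T4_t4.
have wd i : w i i = 0.
  have vS i j := sp4_sym i j (Lsp _ vL).
  move: (vS (inord 0) (inord 2)) (vS (inord 1) (inord 3)).
  rewrite mul_J4 !mxE !inordK// eqxx -{1 2}(inord_val i) => /= v0 v1.
  case: i => [[|[|[|[|i]]]]// hi] /=;
    by rewrite ?v0 ?v1 ?opprK ?subrr ?addNr.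
clearbody w.
have LE : L = (t4 F + <[w]>)%VS.
  apply/esym/eqP; rewrite eqEdim L3 dim_t4_line// leqnn andbT.
  by rewrite subv_add tL -memvE.
have [c cE] : exists c, lie_bracket (T4 1 2%:R) w = c *: w.
  have := Lbr _ _ (subvP tL _ (T4_t4 1 2%:R)) wL; rewrite {1}LE.
  move=> /memv_addP[T Tt [_ /vlineP[c ->] brE]]; exists c; rewrite brE.
  (* A bracket with a diagonal matrix has zero diagonal, and so has [w]; hence so has [T]. *)
  suff -> : T = 0 by rewrite add0r.
  apply: t4_diag0 => // i; have := congr1 (fun A : 'M[F]_4 => A i i) brE.
  by rewrite lie_bracket_T4 !mxE wd !mulr0 addr0 => <-.
have w0 : w != 0 by apply: contraNneq wt => ->; rewrite mem0v.
have [k k0 [i wE]] := weight_vector_root (Lsp _ wL) w0 wd cE.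
exists i; rewrite LE wE; congr (_ + _)%VS; apply/vspaceP => Z.
apply/vlineP/vlineP => -[d ->].
  by exists (d * k); rewrite scalerA.
by exists (d / k); rewrite scalerA divfK.
Qed.

Lemma root_vectorP i : root_vector (root i).
Proof.
split.
- rewrite sp4E; apply/eqP/matrixP => p q; rewrite mul_J4 -[J4 F]opprK -J4_tr.
  rewrite mulNmx opprK -trmx_mul mul_J4 /root_part !mxE !inordK//.
  by case: p q => [[|[|[|[|p]]]]// hp] [[|[|[|[|q]]]]// hq] /=; rewrite ?oppr0 ?opprK.
- apply/negP => /t4_diag0 r0; have : delta_mx 0 i = 0 :> 'rV[F]_8.
    apply: root_part_inj; rewrite -[LHS]/(root i) r0.
      by rewrite -(scale0r (delta_mx 0 i)) root_partZ scale0r.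
    by move=> p; rewrite !mxE; case: p => [[|[|[|[|p]]]]// hp].
  by move=> /rowP/(_ i)/eqP; rewrite !mxE !eqxx oner_eq0.
- move=> a b; exists (root_weight a b)`_i; rewrite root_part_weight -root_partZ.
  congr root_part; apply/rowP => j; rewrite !mxE eqxx /=.
  by case: eqVneq => [->|]; rewrite ?mulr0.
Qed.

Lemma weyl_swap_root_part x : weyl_swap F *m root_part x =
  root_part (\row_j (let r k := x 0 (inord k) in
    [:: r 1; r 0; r 2; r 3; r 6; r 7; r 4; r 5]%N`_j)) *m weyl_swap F.
Proof.
apply/matrixP => i j; rewrite !mxE !sum4E !mxE !inordK//.
by case: i j => [[|[|[|[|i]]]]// hi] [[|[|[|[|j]]]]// hj] /=; ring.
Qed.

Lemma weyl_flip_root_part x : weyl_flip F *m root_part x =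
  root_part (\row_j (let r k := x 0 (inord k) in
    [:: r 2; r 3; - r 0; - r 1; r 4; r 5; - r 7; - r 6]%N`_j)) *m weyl_flip F.
Proof.
apply/matrixP => i j; rewrite !mxE !sum4E !mxE !inordK//.
by case: i j => [[|[|[|[|i]]]]// hi] [[|[|[|[|j]]]]// hj] /=; ring.
Qed.

Definition root_line i := (t4 F + <[root (inord i)]>)%VS.

Ltac root_row :=
  rewrite -root_partZ; congr root_part;
  apply/rowP => - [[|[|[|[|[|[|[|[|j]]]]]]]]// hj];
  by rewrite !mxE /= ?mxE -!val_eqE /= !inordK//=; ring.

Lemma root_line_swap :
  [/\ sp4_equiv (root_line 1) (root_line 0), sp4_equiv (root_line 4) (root_line 6) &
      sp4_equiv (root_line 5) (root_line 7)].
Proof.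
by split; apply: (@weyl_swap_equiv _ _ 1); rewrite ?oner_eq0//;
  rewrite weyl_swap_root_part scalemxAl; congr (_ *m _); root_row.
Qed.

Lemma root_line_flip :
  [/\ sp4_equiv (root_line 2) (root_line 0), sp4_equiv (root_line 3) (root_line 1) &
      sp4_equiv (root_line 7) (root_line 6)].
Proof.
(* The scalar -1 in the third case is the sign with which the flip sends the vector of -alpha to
   that of alpha. *)
by split; [apply: (@weyl_flip_equiv _ _ 1)|apply: (@weyl_flip_equiv _ _ 1)
          |apply: (@weyl_flip_equiv _ _ (-1))];
  rewrite ?oppr_eq0 ?oner_eq0// weyl_flip_root_part scalemxAl; congr (_ *m _); root_row.
Qed.

Lemma named_roots : [/\ root (inord 0) = X_beta F, root (inord 2) = X_alpha_beta F,
  root (inord 4) = X_alpha_2beta F & root (inord 6) = X_alpha F].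
Proof.
have [-> -> -> ->] := root_vectors_M4 F.
by split; apply/matrixP => i j; rewrite !mxE -!val_eqE /= !inordK//=;
  case: i j => [[|[|[|[|i]]]]// hi] [[|[|[|[|j]]]]// hj] /=; rewrite ?oppr0.
Qed.

(** Indices 0 to 3 are the short roots, the orbit of beta; 4 to 7 are the long ones, the orbit of
    alpha. Only -alpha-beta and -alpha-2beta need two reflections. *)
Lemma root_line_equiv (i : 'I_8) :
  sp4_equiv (root_line i) (root_line 6) \/ sp4_equiv (root_line i) (root_line 0).
Proof.
have [s1 s4 s5] := root_line_swap; have [f2 f3 f7] := root_line_flip.
have refl L : sp4_equiv L L.
  by exists 1%:M; [apply: Sp4I; rewrite trmx1 mulmx1 mul1mx|apply: conjv1].
case: i => [[|[|[|[|[|[|[|[|i]]]]]]]]// hi];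
  [right|right|right|right|left|left|left|left] => //=.
- exact: sp4_equiv_trans f3 s1.
- exact: sp4_equiv_trans s5 f7.
Qed.

Lemma alpha_beta_inequiv :
  ~ sp4_equiv (t4 F + <[X_alpha F]>)%VS (t4 F + <[X_beta F]>)%VS.
Proof.
have [bE _ _ aE] := named_roots.
have ar : root_vector (X_alpha F) by rewrite -aE; apply: root_vectorP.
move=> [g /Sp4_unit gu gL].
(* Beta takes the value 1 at [T4 1 0], which exhibits [X_beta F] as a bracket. *)
have TX : lie_bracket (T4 1 0) (X_beta F) = X_beta F.
  rewrite -bE root_part_weight; congr root_part; apply/rowP => j; rewrite !mxE eqxx /=.
  by case: eqVneq => [->|]; rewrite ?mulr0// inordK//= subr0 mulr1.
have /mem_conjv[A AL TE] : T4 1 0 \in conjv g (t4 F + <[X_alpha F]>)%VS.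
  by rewrite gL (subvP (addvSl _ _))// T4_t4.
have /mem_conjv[B BL XE] : X_beta F \in conjv g (t4 F + <[X_alpha F]>)%VS.
  by rewrite gL (subvP (addvSr _ _))// memv_line.
have /vlineP[k kE] := root_bracket ar AL BL.
(* [X_alpha F] is a column times a row; conjugating keeps this form, so [X_beta F] would have rank
   at most 1. *)
pose u : 'cV[F]_4 := g *m (k *: delta_mx (inord 1) 0).
pose w : 'rV[F]_4 := delta_mx 0 (inord 3) *m invmx g.
have uw : X_beta F = u *m w.
  rewrite -TX TE XE lie_bracket_conj// kE /u /w [RHS]mulmxA.
  by rewrite -[X in _ = X *m _]mulmxA -[in RHS]scalemxAl mul_delta_mx.
have := root_vectors_M4 F; rewrite uw => -[_ _ XM _].
have uwE (i j : 'I_4) : (u *m w) i j = u i 0 * w 0 j by rewrite mxE big_ord1.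
have E a b c d : (u *m w) a b * (u *m w) c d = (u *m w) a d * (u *m w) c b.
  by rewrite !uwE; ring.
(* The minor of [X_beta F] on rows 0, 3 and columns 1, 2 is -1, not 0. *)
have /eqP := E (inord 0) (inord 1) (inord 3) (inord 2).
by rewrite XM !mxE !inordK//= mul1r mul0r oppr_eq0 oner_eq0.
Qed.
End RootLines.

Theorem lemma7p1 (R : realType) :
  let t := t4 R[i] in
  let L_alpha := (t + <[X_alpha R[i]]>)%VS in
  let L_beta := (t + <[X_beta R[i]]>)%VS in
  [/\ [/\ solvable3_with_cartan L_alpha,
          solvable3_with_cartan L_beta &
          ~ sp4_equiv L_alpha L_beta],
      (forall L : {vspace 'M[R[i]]_4}, solvable3_with_cartan L ->
         (sp4_equiv L L_alpha /\ ~ sp4_equiv L L_beta) \/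
         (~ sp4_equiv L L_alpha /\ sp4_equiv L L_beta)),
      sp4_equiv L_alpha (t + <[X_alpha_2beta R[i]]>)%VS &
      sp4_equiv L_beta (t + <[X_alpha_beta R[i]]>)%VS].
Proof.
move=> t La Lb.
have [bE abE a2bE aE] := named_roots R[i].
have ineq : ~ sp4_equiv La Lb by apply: alpha_beta_inequiv.
split.
- split=> //; rewrite /La /Lb -?aE -?bE; exact/root_solvable3/root_vectorP.
- move=> L [Lsub L3 _ [H Hc HL]].
  have [g gS gH] := cartan_conj_t4 Hc.
  have [] := @solvable3_t4_root _ (conjv g L).
  + exact: lie_subalgebra_conj.
  + by rewrite dim_conjv ?Sp4_unit.
  + by rewrite -gH limgS.
  move=> i gL; have Lr : sp4_equiv L (root_line R[i] i).
    by exists g => //; rewrite /root_line inord_val.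
  (* Equivalence to both algebras would, by transitivity, contradict [ineq]. *)
  have := root_line_equiv R[i] i; rewrite {2 4}/root_line bE aE => -[ra|rb]; [left|right].
    have La' := sp4_equiv_trans Lr ra; split=> // /(sp4_equiv_trans (sp4_equiv_sym La')).
    exact: ineq.
  have Lb' := sp4_equiv_trans Lr rb; split=> // La'.
  exact/ineq/(sp4_equiv_trans (sp4_equiv_sym La')).
- have [_ e _] := root_line_swap R[i]; apply: sp4_equiv_sym.
  by rewrite -a2bE /La -aE.
- have [e _ _] := root_line_flip R[i]; apply: sp4_equiv_sym.
  by rewrite -abE /Lb -bE.
Qed.
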